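(* Assume that $\bar\mu(\rho)>0$ and $\varepsilon(\rho)>0$ for $\rho>0$. Let $(\rho,m)$ be a $C^2$ solution, with periodic boundary condition and $\rho\ge 0$, of the stationary one-dimensional isothermal Navier-Stokes-Korteweg equations $$\partial_x m = 0,\qquad \partial_x\!\left(\frac{m^2}{\rho}\right)+\partial_x p-\partial_x\big(\bar\mu\,\partial_x u\big)=\rho\,\partial_x\big(\varepsilon\,\partial_x^2\rho\big)\quad\text{in }\mathbb{R}$$ (the first equation says that $m$ is a constant). Then $\rho$ must be a constant provided that $m\neq 0$.
   Context: Here $\rho=\rho(x)$ is the density, $m=m(x)$ is the (scalar) momentum, and $u=m/\rho$ is the velocity. The pressure $p=p(\rho)$ is a given function that is locally Lipschitz for $\rho>0$; it is not assumed to be monotone in $\rho$. The Korteweg relaxation parameter $\varepsilon=\varepsilon(\rho)$ is a given function, continuous for $\rho\ge 0$. The viscosity is $\bar\mu=\bar\mu(\rho)=\lambda(\rho)+2\mu(\rho)$, where $\mu$ is the shear viscosity and $\lambda$ is the bulk viscosity. Periodic boundary condition means that $(\rho,m)$ is periodic in $x$ with some period $\omega>0$. *)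

(* Defs.v *)
From mathcomp Require Import all_boot all_order all_algebra.
From mathcomp Require Import all_classical all_reals all_analysis.
Set Implicit Arguments.
Unset Strict Implicit.
Unset Printing Implicit Defensive.
Import Order.TTheory GRing.Theory Num.Theory.
Import numFieldNormedType.Exports.
Local Open Scope classical_set_scope.
Local Open Scope ring_scope.

(* C^n(R) *)
Definition Ck (R : realType) (n : nat) (f : R -> R) : Prop :=
  (forall k, (k < n)%N -> forall x, derivable (derive1n k f) x 1) /\
  continuous (derive1n n f).

Definition locally_lipschitz (R : realType) (A : set R) (f : R -> R) : Prop :=
  forall x, A x -> exists2 U, nbhs x U & [lipschitz f y | y in U].

(* L^1_loc(R), for functions that may take infinite values *)
Definition loc_integrable (R : realType) (f : R -> \bar R) : Prop :=
  forall K : set R, compact K -> (@lebesgue_measure R).-integrable K f.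

(* C^oo_c(R) *)
Definition test_function (R : realType) (phi : R -> R) : Prop :=
  (forall n, Ck n phi) /\ exists M : R, forall x, M < `|x| -> phi x = 0.

(* Derivative of f in L^1_loc in the sense of distributions.  It is of order at
   most one, hence acts on every compactly supported C^1 function phi. *)
Definition distr_deriv (R : realType) (f phi : R -> R) : R :=
  - (\int[lebesgue_measure]_(x in setT) (f x * derive1 phi x)).

(* Product of a functional by a function *)
Definition distr_mul (R : realType) (a : R -> R) (T : (R -> R) -> R) :
  (R -> R) -> R := fun phi => T (a \* phi).

Section StationaryNSK.
Variables (R : realType) (p eps lam mu : R -> R) (rho m : R -> R).

Definition total_viscosity (r : R) : R := lam r + 2 * mu r.

(* rho is only C^2 and p only locally Lipschitz, so the outer derivatives of the
   momentum balance need not exist pointwise: they are taken in the sense of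
   distributions, which for classical solutions is implied by the pointwise
   equation. *)
Definition velocity (x : R) : R := m x / rho x.
Definition momentum_flux (x : R) : R := m x ^+ 2 / rho x.
Definition pressure (x : R) : R := p (rho x).
Definition viscous_stress (x : R) : R :=
  total_viscosity (rho x) * derive1 velocity x.
Definition korteweg (x : R) : R := eps (rho x) * derive1n 2 rho x.

(* The first integrability condition is over \bar R, where 0^-1 = +oo and
   0 * +oo = 0: at a vacuum point m ^ 2 / rho is +oo unless m vanishes there.
   It makes momentum_flux, whose division is the total one of R, agree almost
   everywhere with m ^ 2 / rho. *)
Definition flux_integrability : Prop :=
  [/\ loc_integrable (fun x => ((m x ^+ 2)%:E * ((rho x)%:E)^-1)%E),
      loc_integrable (EFin \o pressure),
      loc_integrable (EFin \o viscous_stress) &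
      loc_integrable (EFin \o korteweg)].

Definition mass_equation : Prop := forall x, derive1 m x = 0.

Definition momentum_equation : Prop :=
  forall phi, test_function phi ->
    distr_deriv momentum_flux phi + distr_deriv pressure phi
      - distr_deriv viscous_stress phi
    = distr_mul rho (distr_deriv korteweg) phi.

Definition C2_solution : Prop :=
  [/\ Ck 2 rho, Ck 2 m, flux_integrability, mass_equation & momentum_equation].

End StationaryNSK.

(* Main.v *)
Require Import Defs.
From HB Require Import structures.
From mathcomp Require Import all_boot all_order all_algebra.
From mathcomp Require Import all_classical all_reals all_analysis.
From mathcomp Require Import measurable_realfun.
From mathcomp Require Import ring lra.
Import Order.TTheory GRing.Theory Num.Theory.
Import numFieldNormedType.Exports.
Local Open Scope classical_set_scope.
Local Open Scope ring_scope.

(** Write [m0] for the constant momentum, [u = m0 / rho] for the velocity and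
    [K = eps(rho) rho''] for the Korteweg term.

    There is no vacuum: a nonnegative differentiable function is [o(|x - x0|)]
    at a zero [x0], so that [m0^2 / rho] could not be integrable near [x0]
    ([loc_integrable_inv_gt0]).  Hence [rho > 0], and [K] and [p(rho)] are
    continuous.

    Formally, [rho' = 0] results from testing the momentum balance against
    [1 / rho] over a period: the Korteweg term disappears because
    [(rho . 1 / rho)' = 0], and, [u'] being proportional to [(1 / rho)'], the
    convective and pressure terms are exact derivatives and only the dissipation
    [mubar(rho) u'^2] is left, which must therefore vanish.

    As the balance is known only against compactly supported smooth functions
    and [mubar] is an arbitrary function, it is integrated once instead.  With
    [G] a primitive of [K rho'], the right-hand side is the distributional
    derivative of [K rho - G] ([distr_mul_deriv]), so that the lemma of
    du Bois-Reymond provides a constant [c] such that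
    [mubar(rho) u' = H := m0^2 / rho + p(rho) - K rho + G - c] on a dense set
    ([du_bois_reymond_dense]).  The latter lemma is proved at Lebesgue points by
    means of differences of two steep smooth steps, which are test functions.
    Then [H u'] is nonnegative on a dense set, hence everywhere by continuity,
    and it is the derivative of
    [W = m0 u^2 / 2 + Q(ln rho) + u (G - c)] with [Q'(t) = - m0 p(e^t) e^-t].
    If [W] is periodic, it is constant, hence [H u' = 0], [u' = 0] on a dense
    set and so [u' = 0] ([energy_argument]).  Now [W] is periodic if [G] is,
    and [G] increases by a constant [d] over a period: [(H + n d) u' >= 0] for
    all [n] gives [d u' >= 0], so that the periodic function [d u] is constant
    and either [d = 0] or [u' = 0] already. *)

Set Implicit Arguments.
Unset Strict Implicit.

(** * Smooth functions *)

(** The functions [x^-k exp(-1/x)] on the positive half line, extended by 0. *)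
Definition flat (R : realType) (k : nat) (x : R) : R :=
  if 0 < x then x^-1 ^+ k * expR (- x^-1) else 0.

Lemma flat_ge0 (R : realType) k (x : R) : 0 <= flat k x.
Proof.
rewrite /flat; case: ifPn => // x0.
by rewrite mulr_ge0 ?expR_ge0// exprn_ge0// invr_ge0 ltW.
Qed.

(** All the functions [flat k] are [O(x)] at 0; as [flat k x / x = flat k.+1 x],
    this gives their differentiability there. *)
Lemma flat_le (R : realType) k (x : R) : `|flat k x| <= k.+1`!%:R * `|x|.
Proof.
rewrite ger0_norm ?flat_ge0//; rewrite /flat; case: ifPn => x0; last first.
  by rewrite mulr_ge0.
have xi0 : 0 <= x^-1 by rewrite invr_ge0 ltW.
have f0 : 0 < k.+1`!%:R :> R by rewrite ltr0n fact_gt0.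
have h : x^-1 ^+ k.+1 / k.+1`!%:R <= expR x^-1.
  by apply: le_trans (expR_ge1Dxn k xi0); rewrite lerDr.
rewrite expRN ler_pdivrMr ?expR_gt0// gtr0_norm//.
rewrite -(ler_pM2l x0) -(ler_pM2l f0) in h.
rewrite -mulrA; apply: le_trans h.
by rewrite mulrCA (mulrC (_ ^+ _)) mulVKf ?gt_eqF// exprS mulVKf ?gt_eqF.
Qed.

Lemma is_derive_flat (R : realType) k (x : R) :
  is_derive x (1 : R) (flat k) (flat k.+2 x - k%:R * flat k.+1 x).
Proof.
have [x0|x0|->] := ltgtP x 0.
- have -> : flat k.+2 x - k%:R * flat k.+1 x = 0.
    by rewrite /flat (lt_gtF x0) mulr0 subr0.
  have h : \near x, cst 0 x = flat k x.
    near=> y; rewrite /flat ifF//; apply: lt_gtF.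
    by near: y; exact: lt_nbhsl.
  exact: near_eq_is_derive h (is_derive_cst _ _ _).
- rewrite {2 3}/flat x0.
  have h : \near x, x^-1 ^+ k * expR (- x^-1) = flat k x.
    near=> y; rewrite /flat ifT//.
    by near: y; exact: lt_nbhsr.
  apply: (near_eq_is_derive h).
  have xn0 : x != 0 by rewrite gt_eqF.
  have di : is_derive x (1:R) (fun y : R => y^-1) (- x^-1 ^+ 2).
    have := @is_deriveV R id x 1 1 xn0 _.
    by move=> /(_ _)/is_derive_eq; apply; rewrite /= scaler1 exprVn.
  have de : is_derive x (1:R) (fun y : R => expR (- y^-1))
     (expR (- x^-1) * x^-1 ^+ 2).
    apply: (@is_derive1_comp _ expR (fun y => - y^-1)).
    by apply: is_derive_eq; rewrite opprK.
  have dX j : is_derive x (1:R) (fun y : R => y^-1 ^+ j)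
      (- j%:R * x^-1 ^+ j.+1).
    elim: j => [|j IH].
      by rewrite mulNr mul0r oppr0; exact: is_derive_cst.
    have -> : (fun y : R => y^-1 ^+ j.+1) = (fun y => y^-1 * y^-1 ^+ j).
      by apply/funext => y; rewrite exprS.
    apply: (is_derive_eq (is_deriveM di IH)).
    by rewrite /GRing.scale/= -natr1 !exprS; ring.
  apply: (is_derive_eq (is_deriveM (dX k) de)).
  by rewrite /GRing.scale/= !exprS; ring.
- rewrite {2 3}/flat ltxx mulr0 subr0.
  suff h : (fun h => h^-1 *: ((flat k \o shift 0) (h *: (1:R)) - flat k 0))
      @ 0^' --> (0:R).
    by apply: DeriveDef; [apply/cvg_ex; exists 0|exact/cvg_lim].
  apply/cvgr0Pnorm_le => e e0.
  near=> h.
  have hn0 : h != 0 by near: h; exact: nbhs_dnbhs_neq.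
  rewrite /= addr0 scaler1 {2}/flat ltxx subr0.
  have -> : h^-1 *: flat k h = flat k.+1 h.
    rewrite /flat; case: ifPn => h0; last by rewrite scaler0.
    by rewrite exprS -mulrA.
  apply: le_trans (flat_le _ _) _.
  rewrite mulrC -ler_pdivlMr ?ltr0n ?fact_gt0//.
  near: h; apply: dnbhs0_le.
  by rewrite divr_gt0// ltr0n fact_gt0.
Unshelve. all: by end_near. Qed.

(** The algebra of functions generated by the constants and the functions
    [flat k], stable under affine changes of variable and under inversion of
    nowhere vanishing functions.  It is stable under derivation, so that its
    elements are smooth. *)
Inductive flat_algebra (R : realType) : (R -> R) -> Prop :=
| flat_algebra_cst c : flat_algebra (fun=> c)
| flat_algebra_flat k : flat_algebra (flat k)
| flat_algebraD f g :
    flat_algebra f -> flat_algebra g -> flat_algebra (fun x => f x + g x)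
| flat_algebraM f g :
    flat_algebra f -> flat_algebra g -> flat_algebra (fun x => f x * g x)
| flat_algebraV f : (forall x, f x != 0) ->
    flat_algebra f -> flat_algebra (fun x => (f x)^-1)
| flat_algebra_affine f a b :
    flat_algebra f -> flat_algebra (fun x => f (a * x + b)).

Lemma flat_algebra_derive (R : realType) (f : R -> R) : flat_algebra f ->
  exists2 g : R -> R, flat_algebra g & forall x : R, is_derive x 1 f (g x).
Proof.
elim => {f} [c|k|f g af [f' af' df] ag [g' ag' dg]
  |f g af [f' af' df] ag [g' ag' dg]|f f0 af [f' af' df]|f a b af [f' af' df]].
- exists (fun=> 0) => [|x]; [exact: flat_algebra_cst|exact: is_derive_cst].
- exists (fun x => flat k.+2 x + (fun x => (fun=> - k%:R) x * flat k.+1 x) x).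
    apply: flat_algebraD; first exact: flat_algebra_flat.
    by apply: flat_algebraM; [exact: flat_algebra_cst|exact: flat_algebra_flat].
  by move=> x; apply: (is_derive_eq (is_derive_flat _ _)); rewrite mulNr.
- exists (fun x => f' x + g' x); first exact: flat_algebraD.
  by move=> x; exact: is_deriveD.
- exists (fun x => (fun x => f x * g' x) x + (fun x => g x * f' x) x).
    by apply: flat_algebraD; exact: flat_algebraM.
  by move=> x; exact: is_deriveM.
- exists (fun x => (fun x => (fun=> -1) x * (fun x => (f x)^-1 * (f x)^-1) x) x
      * f' x).
    apply: flat_algebraM => //; apply: flat_algebraM.
      exact: flat_algebra_cst.
    by apply: flat_algebraM; exact: flat_algebraV.
  move=> x; apply: (is_derive_eq (@is_deriveV _ f x _ _ (f0 x) (df x))).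
  by rewrite /GRing.scale/= mulN1r expr2 invfM.
- exists (fun x => (fun x => f' (a * x + b)) x * (fun=> a) x).
    by apply: flat_algebraM;
      [exact: flat_algebra_affine|exact: flat_algebra_cst].
  move=> x; apply: (@is_derive1_comp _ f (fun x => a * x + b)).
  by apply: is_derive_eq; rewrite /GRing.scale/= mulr1 addr0.
Qed.

Lemma flat_algebra_Ck (R : realType) (f : R -> R) : flat_algebra f ->
  forall n, Ck n f.
Proof.
move=> af.
have an n : flat_algebra (derive1n n f).
  elim: n => [//|n IH]; have [g ag dg] := flat_algebra_derive IH.
  rewrite derive1nS; suff -> : derive1 (derive1n n f) = g by [].
  by apply/funext => x; rewrite derive1E; exact: derive_val.
have dn n x : derivable (derive1n n f) x 1.
  by have [g ag dg] := flat_algebra_derive (an n); exact: ex_derive.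
move=> n; split=> [k _ x|x]; first exact: dn.
by apply: differentiable_continuous; exact/derivable1_diffP/dn.
Qed.

(** A smooth step: 0 on the left of 0 and 1 on the right of 1. *)
Definition smooth_step (R : realType) (x : R) : R :=
  flat 0 x * (flat 0 x + flat 0 (- 1 * x + 1))^-1.

Lemma flat_algebra_smooth_step (R : realType) :
  flat_algebra (@smooth_step R).
Proof.
rewrite /smooth_step.
apply: (@flat_algebraM _ (flat 0)
  (fun x => (flat 0 x + flat 0 (-1 * x + 1))^-1)).
  exact: flat_algebra_flat.
apply: flat_algebraV; last first.
  apply: (@flat_algebraD _ (flat 0) (fun x => flat 0 (-1 * x + 1))).
    exact: flat_algebra_flat.
  exact/flat_algebra_affine/flat_algebra_flat.
(* one of [x] and [1 - x] is positive *)
move=> x; rewrite gt_eqF//.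
have [x0|x0] := ltP 0 x.
  by rewrite ltr_pwDl ?flat_ge0// /flat x0 mulr_gt0 ?expR_gt0 ?exprn_gt0 ?invr_gt0.
have x1 : 0 < -1 * x + 1 by lra.
by rewrite ltr_wpDl ?flat_ge0// /flat x1 mulr_gt0 ?expR_gt0 ?exprn_gt0 ?invr_gt0.
Qed.

Lemma smooth_step_le0 (R : realType) (x : R) : x <= 0 -> smooth_step x = 0.
Proof. by move=> x0; rewrite /smooth_step /flat ltNge x0/= mul0r. Qed.

Lemma smooth_step_ge1 (R : realType) (x : R) : 1 <= x -> smooth_step x = 1.
Proof.
move=> x1; rewrite /smooth_step {3}/flat ifF; last by lra.
rewrite addr0 mulfV// /flat ifT; last by lra.
by rewrite gt_eqF// mulr_gt0 ?expR_gt0.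
Qed.

(** * Integrals against compactly supported functions *)

Lemma ae_dense (R : realType) (P : R -> Prop) :
  {ae (@lebesgue_measure R), forall x, P x} ->
  forall a b, a < b -> exists2 x, a < x < b & P x.
Proof.
move=> [N [mN N0 PN]] a b ab; apply: contrapT => /forall2NP noP.
suff : (lebesgue_measure (`]a, b[%classic : set R) <= 0)%E.
  by rewrite lebesgue_measure_itv/= lte_fin ab -EFinB lee_fin subr_le0 leNgt ab.
rewrite -N0; apply: le_measure; rewrite ?inE//.
move=> x; rewrite /= in_itv/= => xab; apply: PN => /=.
by case: (noP x).
Qed.

Lemma loc_integrable_locally (R : realType) (f : R -> R) :
  loc_integrable (EFin \o f) -> locally_integrable setT f.
Proof.
move=> fi; split; [|exact: openT|]; last first.
  move=> K _ cK; have /integrableP[_] := fi K cK.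
  by congr (_ < _)%E; apply: eq_integral.
rewrite -(@bigcup_itvT R true false) measurable_fun_bigcup//.
move=> n; have /integrableP[/measurable_EFinP] :=
  fi _ (@segment_compact R (- n%:R) n%:R).
by [].
Qed.

Lemma integrable_mul_support (R : realType) (f g : R -> R) (a b : R) :
  loc_integrable (EFin \o f) -> continuous g ->
  (forall x, x \notin `[a, b] -> g x = 0) ->
  (@lebesgue_measure R).-integrable setT (EFin \o (f \* g)).
Proof.
move=> fi cg g0.
have -> : EFin \o (f \* g) = ((EFin \o f) \* (EFin \o g))%E \_ `[a, b].
  apply/funext => x; rewrite patchE/=; case: ifPn => //.
  by rewrite notin_setE/= => /negP /g0 ->; rewrite mulr0.
apply/integrable_restrict => //; rewrite setTI.
have cK := @segment_compact R a b.
apply: integrableMl => //.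
- exact: fi.
- by apply: measurable_funTS; exact: continuous_measurable_fun.
- have /compact_bounded[M [_ mrt]] :=
    continuous_compact (continuous_subspaceT cg) cK.
  by exists M; split; rewrite ?num_real // => ? ? ? ?; exact: mrt.
Qed.

Lemma continuous_loc_integrable (R : realType) (f : R -> R) :
  continuous f -> loc_integrable (EFin \o f).
Proof.
by move=> cf K cK; apply: continuous_compact_integrable => //;
  exact: continuous_subspaceT.
Qed.

Lemma Rintegral_derive_support (R : realType) (F f : R -> R) (a b : R) :
  a < b -> (forall x : R, is_derive x 1 F (f x)) -> continuous f ->
  (forall x, x \notin `[a, b] -> f x = 0) ->
  \int[lebesgue_measure]_(x in setT) f x = F b - F a.
Proof.
move=> ab dF cf f0.
have cF : continuous F.
  by move=> x; apply: differentiable_continuous; apply/derivable1_diffP;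
    exact: ex_derive.
transitivity (\int[lebesgue_measure]_(x in `[a, b]) f x).
  rewrite [RHS]Rintegral_mkcond; apply: eq_Rintegral => x _.
  rewrite patchE; case: ifPn => //.
  by rewrite notin_setE/= => /negP /f0 ->.
rewrite /Rintegral (@continuous_FTC2 _ f F)//.
- exact: continuous_subspaceT.
- split=> [x _||]; first exact: ex_derive.
  + exact/cvg_at_right_filter/cF.
  + exact/cvg_at_left_filter/cF.
- by move=> x _; rewrite derive1E; exact: derive_val.
Qed.

(** * The lemma of du Bois-Reymond *)

Section du_bois_reymond.
Variable R : realType.
Local Notation mu := (@lebesgue_measure R).
Local Notation bump := (derive1 (@smooth_step R)).

Let is_derive_step (x : R) : is_derive x 1 (@smooth_step R) (bump x).
Proof.
have [g _ dg] := flat_algebra_derive (flat_algebra_smooth_step R).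
by rewrite derive1E; apply: derivableP; exact: ex_derive.
Qed.

Let continuous_bump : continuous bump.
Proof. by have [] := flat_algebra_Ck (flat_algebra_smooth_step R) 1. Qed.

Lemma derive1_smooth_step_out (x : R) : x \notin `[0, 1] -> bump x = 0.
Proof.
rewrite in_itv/= negb_and -!ltNge => /orP[x0|x1].
- rewrite derive1E; apply: (@derive_val _ _ _ x 1 (@smooth_step R)).
  have h : \near x, cst 0 x = smooth_step x.
    near=> y; rewrite smooth_step_le0//; apply: ltW.
    by near: y; exact: lt_nbhsl.
  exact: near_eq_is_derive h (is_derive_cst _ _ _).
- rewrite derive1E; apply: (@derive_val _ _ _ x 1 (@smooth_step R)).
  have h : \near x, cst 1 x = smooth_step x.
    near=> y; rewrite smooth_step_ge1//; apply: ltW.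
    by near: y; exact: lt_nbhsr.
  exact: near_eq_is_derive h (is_derive_cst _ _ _).
Unshelve. all: by end_near. Qed.

Lemma derive1_smooth_step_bounded :
  exists2 C : R, 0 < C & forall x, `|bump x| <= C.
Proof.
have /compact_bounded[M [_ mrt]] := continuous_compact
  (continuous_subspaceT continuous_bump) (@segment_compact R 0 1).
exists (`|M| + 1); first by rewrite ltr_wpDl.
move=> x; case: (boolP (x \in `[0, 1])) => [x01|/derive1_smooth_step_out ->].
  apply: mrt; last by exists x.
  by rewrite (le_lt_trans (ler_norm _))// ltrDl.
by rewrite normr0 addr_ge0.
Qed.

(* the smooth step from [a] to [a + k^-1], and its derivative *)
Local Notation step k a := (fun x => smooth_step (k * x + - (k * a))).
Local Notation dstep k a := (fun x => k * bump (k * x + - (k * a))).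

Let is_derive_stepk (k a x : R) : is_derive x 1 (step k a) (dstep k a x).
Proof.
have dl : is_derive x 1 (fun x => k * x + - (k * a)) k.
  by apply: is_derive_eq; rewrite /GRing.scale/= ?(mulr0, addr0, oppr0, mulr1).
apply: (is_derive_eq (is_derive1_comp (is_derive_step _) dl)).
exact: mulrC.
Qed.

Let continuous_dstep (k a : R) : continuous (dstep k a).
Proof.
move=> x; apply: cvgM; first exact: cvg_cst.
apply: (@continuous_comp _ _ _ (fun x => k * x + - (k * a)) bump);
  last exact: continuous_bump.
by apply: cvgD; [apply: cvgM; [exact: cvg_cst|exact: cvg_id]|exact: cvg_cst].
Qed.

Let dstep_out (k a x : R) : 0 < k -> x \notin `[a, a + k^-1] -> dstep k a x = 0.
Proof.
move=> k0 xa; rewrite /= derive1_smooth_step_out ?mulr0//.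
apply: contra xa; rewrite -mulrBr !in_itv/= pmulr_rge0// subr_ge0.
by rewrite -ler_pdivlMl// mulr1 lerBlDl.
Qed.

Let int_dstep (k a : R) : 0 < k -> \int[mu]_(x in setT) dstep k a x = 1.
Proof.
move=> k0.
have aak : a < a + k^-1 by rewrite ltrDl invr_gt0.
rewrite (Rintegral_derive_support aak (is_derive_stepk k a)
  (@continuous_dstep k a) (fun x => @dstep_out k a x k0)).
rewrite mulrDr mulfV ?gt_eqF// addrAC subrr add0r.
by rewrite smooth_step_ge1// smooth_step_le0// subr0.
Qed.

Lemma test_function_smooth_step (k a b : R) : 0 < k ->
  test_function (fun x => step k a x - step k b x).
Proof.
move=> k0; split.
  apply: flat_algebra_Ck.
  have -> : (fun x => step k a x - step k b x) =
      (fun x => step k a x + (fun x => (fun=> -1) x * step k b x) x).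
    by apply/funext => x; rewrite mulN1r.
  apply: flat_algebraD; last apply: flat_algebraM.
  - exact/flat_algebra_affine/flat_algebra_smooth_step.
  - exact: flat_algebra_cst.
  - exact/flat_algebra_affine/flat_algebra_smooth_step.
exists (`|a| + `|b| + k^-1) => x.
have ki : 0 < k^-1 by rewrite invr_gt0.
have ha := ler_norm a; have hb := ler_norm b.
have ha' := ler_norm (- a); have hb' := ler_norm (- b).
rewrite !normrN in ha' hb'.
have := normr_ge0 a; have := normr_ge0 b => na nb.
rewrite lter_normr => /orP[xM|xM].
  rewrite !smooth_step_ge1 ?subrr// -mulrBr -ler_pdivrMl// mulr1; lra.
by rewrite !smooth_step_le0 ?subrr// -mulrBr pmulr_rle0//; lra.
Qed.

(* For [k = 2 / r] the step ends at [a + r / 2], well inside the ball of radius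
   [r] over which Lebesgue points average. *)
Let dstep_out_ball (a r x : R) : 0 < r -> ~ ball a r x ->
  dstep (2 / r) a x = 0.
Proof.
move=> r0 xar; apply: dstep_out; first by rewrite divr_gt0.
apply/negP; rewrite invf_div in_itv/= => /andP[ax xa]; apply: xar.
rewrite ball_itv/= in_itv/=; apply/andP; split.
  by rewrite (lt_le_trans _ ax)// gtrBl.
by rewrite (le_lt_trans xa)// ltrD2l ltr_pdivrMr// ltr_pMr// ltr1n.
Qed.

(** At a Lebesgue point the averages of [f] against the derivatives of steeper
    and steeper steps converge to the value of [f]. *)
Lemma lebesgue_pt_dstep (f : R -> R) (a : R) :
  loc_integrable (EFin \o f) -> lebesgue_pt f a -> forall e : R, 0 < e ->
  \forall r \near 0^'+,
    `|\int[mu]_(x in setT) (f x * dstep (2 / r) a x) - f a| <= e.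
Proof.
move=> fi fa e e0.
have [C C0 HC] := derive1_smooth_step_bounded.
have e4C : 0 < e / (4 * C) by rewrite divr_gt0// mulr_gt0.
have /fine_cvgP[davgfin /cvgr0Pnorm_le/(_ _ e4C) davge] := fa.
near=> r.
have r0 : 0 < r by near: r; exact: nbhs_right_gt.
have k0 : 0 < 2 / r by rewrite divr_gt0.
pose D := dstep (2 / r) a; rewrite -/(D _).
(* [D] has integral 1, so that [f a] can be brought under the integral *)
pose g x := f x - f a.
have ci : loc_integrable (EFin \o (fun=> f a) : R -> \bar R).
  by apply: continuous_loc_integrable => x; exact: cvg_cst.
have gi : loc_integrable (EFin \o g).
  move=> K cK.
  have -> : EFin \o g = ((EFin \o f) \- (EFin \o (fun=> f a)))%E.
    by apply/funext => x /=; rewrite EFinB.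
  by apply: integrableB; [exact: compact_measurable|exact: fi|exact: ci].
have cD : continuous D by exact: continuous_dstep.
have D0 x : x \notin `[a, a + (2 / r)^-1] -> D x = 0 by exact: dstep_out.
have gD := integrable_mul_support gi cD D0.
have cDi := integrable_mul_support ci cD D0.
have -> : \int[mu]_(x in setT) (f x * D x) - f a =
    \int[mu]_(x in setT) (g x * D x).
  have -> : \int[mu]_(x in setT) (f x * D x) =
      \int[mu]_(x in setT) (g x * D x + f a * D x).
    by apply: eq_Rintegral => x _; rewrite -mulrDl subrK.
  have Di : mu.-integrable setT (EFin \o D).
    have -> : EFin \o D = EFin \o ((fun=> 1) \* D).
      by apply/funext => x /=; rewrite mul1r.
    apply: integrable_mul_support cD D0 => //.
    by apply: continuous_loc_integrable => x; exact: cvg_cst.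
  by rewrite RintegralD// (RintegralZl _ measurableT Di) int_dstep// mulr1 addrK.
have mB : measurable (ball a r : set R) by exact: measurable_ball.
have Bcl : ball a r `<=` `[a - r, a + r]%classic.
  by rewrite ball_itv; exact: subset_itv_oo_cc.
have giB : mu.-integrable (ball a r) (EFin \o g).
  have := gi _ (@segment_compact R (a - r) (a + r)).
  by apply: integrableS.
have nB : mu.-integrable (ball a r) (EFin \o (fun x => `|g x|)).
  exact: integrable_abse giB.
(* [`|D| <= 2 / r * C] and the ball has measure [2 * r], whence the bound
   [4 * C * davg f a r] *)
apply: (le_trans (le_normr_Rintegral _ gD)) => //.
have -> : \int[mu]_(x in setT) `|(g \* D) x| =
    \int[mu]_(x in ball a r) (`|g x| * `|D x|).
  rewrite [RHS]Rintegral_mkcond; apply: eq_Rintegral => x _.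
  rewrite patchE -normrM; case: ifPn => //.
  rewrite notin_setE => /(dstep_out_ball r0) Dx0.
  by rewrite /= -/(D x) [D x]Dx0 mulr0 normr0.
apply: (@le_trans _ _ (\int[mu]_(x in ball a r) (`|g x| * (2 / r * C)))).
  apply: le_Rintegral => //.
  - have -> : EFin \o (fun x => `|g x| * `|D x|) =
        abse \o (EFin \o (g \* D)).
      by apply/funext => x; congr EFin; exact/esym/normrM.
    by apply: integrable_abse => //; move: gD; apply: integrableS.
  - rewrite (_ : _ \o _ = (EFin \o (fun x => `|g x|%R)) \*
        cst (2 / r * C)%:E)%E.
      by apply: integrableZr.
    by apply/funext => x /=; rewrite EFinM.
  - move=> x _; rewrite ler_wpM2l// normrM gtr0_norm// ler_wpM2l//.
    exact: ltW.
rewrite RintegralZr//.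
have -> : \int[mu]_(x in ball a r) `|g x| = r *+ 2 * fine (davg f a r).
  rewrite /davg /iavg (lebesgue_measure_ball _ (ltW r0)).
  rewrite inver mulrn_eq0/= gt_eqF// fineM//; last first.
    exact: integrable_fin_num nB.
  by rewrite /= mulVKf// mulrn_eq0/= gt_eqF.
have : `|fine (davg f a r)| <= e / (4 * C) by near: r.
move=> /(le_trans (ler_norm _)); rewrite ler_pdivlMr ?mulr_gt0//.
apply: le_trans; rewrite le_eqVlt; apply/orP; left; apply/eqP.
rewrite -mulr_natl; field.
by rewrite gt_eqF.
Unshelve. all: by end_near. Qed.

(** An identity tested against compactly supported smooth functions only
    determines a locally integrable function at its Lebesgue points. *)
Theorem du_bois_reymond (f : R -> R) :
  loc_integrable (EFin \o f) ->
  (forall phi, test_function phi ->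
    \int[mu]_(x in setT) (f x * derive1 phi x) = 0) ->
  forall a b, lebesgue_pt f a -> lebesgue_pt f b -> f a = f b.
Proof.
move=> fi f0 a b fa fb; apply/eqP; rewrite -subr_eq0 -normr_le0.
apply/ler_addgt0Pl => e e0; rewrite addr0.
have e2 : 0 < e / 2 by rewrite divr_gt0.
near (0 : R)^'+ => r.
have r0 : 0 < r by near: r; exact: nbhs_right_gt.
have k0 : 0 < 2 / r by rewrite divr_gt0.
have := f0 _ (test_function_smooth_step a b k0).
have dE x : derive1 (fun x => step (2 / r) a x - step (2 / r) b x) x =
    dstep (2 / r) a x - dstep (2 / r) b x.
  rewrite derive1E; apply: derive_val.
  exact: is_deriveB (is_derive_stepk _ _ _) (is_derive_stepk _ _ _).
under eq_Rintegral do rewrite dE mulrBr.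
have ic c := integrable_mul_support fi (@continuous_dstep (2 / r) c)
  (fun x => @dstep_out (2 / r) c x k0).
rewrite RintegralB//; [|exact: ic|exact: ic].
move=> /eqP; rewrite subr_eq0 => /eqP ab.
have ha : `|\int[mu]_(x in setT) (f x * dstep (2 / r) a x) - f a| <= e / 2.
  by near: r; exact: lebesgue_pt_dstep.
have hb : `|\int[mu]_(x in setT) (f x * dstep (2 / r) b x) - f b| <= e / 2.
  by near: r; exact: lebesgue_pt_dstep.
rewrite ab distrC in ha.
have := ler_distD (\int[mu]_(x in setT) (f x * dstep (2 / r) b x)) (f a) (f b).
move=> /le_trans; apply.
by rewrite (splitr e) lerD.
Unshelve. all: by end_near. Qed.

Corollary du_bois_reymond_dense (f : R -> R) :
  loc_integrable (EFin \o f) ->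
  (forall phi, test_function phi ->
    \int[mu]_(x in setT) (f x * derive1 phi x) = 0) ->
  exists c, forall a b, a < b -> exists2 x, a < x < b & f x = c.
Proof.
move=> fi f0.
have dense := ae_dense (lebesgue_differentiation (loc_integrable_locally fi)).
have [y _ fy] := dense 0 1 ltr01.
exists (f y) => a b ab; have [x xab fx] := dense _ _ ab.
by exists x => //; exact: du_bois_reymond.
Qed.

End du_bois_reymond.

(** * One-variable calculus on the line *)

Lemma is_derive_continuous (R : realType) (f g : R -> R) :
  (forall x : R, is_derive x 1 f (g x)) -> continuous f.
Proof.
move=> df x; apply: differentiable_continuous; apply/derivable1_diffP.
exact: ex_derive.
Qed.

Lemma continuous_primitive (R : realType) (f : R -> R) : continuous f ->
  exists F : R -> R, forall x : R, is_derive x 1 F (f x).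
Proof.
move=> cf.
have fi (a b : R) : (@lebesgue_measure R).-integrable `[a, b] (EFin \o f).
  by apply: continuous_loc_integrable => //; exact: segment_compact.
pose P (N x : R) := \int[lebesgue_measure]_(t in `[- N, x]) f t -
  \int[lebesgue_measure]_(t in `[- N, 0]) f t.
(* the value of P N x does not depend on N as soon as |x| <= N *)
have PNM (N M x : R) : `|x| <= N -> N <= M -> P N x = P M x.
  move=> xN NM; have N0 : 0 <= N by rewrite (le_trans _ xN).
  have split_at (y : R) : - N <= y -> \int[lebesgue_measure]_(t in `[- M, y]) f t =
      \int[lebesgue_measure]_(t in `[- M, - N]) f t +
      \int[lebesgue_measure]_(t in `[- N, y]) f t.
    move=> Ny; apply/eqP; rewrite addrC -subr_eq; apply/eqP.
    rewrite Rintegral_itvB ?bnd_simp ?lerN2//.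
    rewrite Rintegral_itv_obnd_cbnd//; apply: integrableS (fi (- N) y) => //.
    by apply: subset_itvr; rewrite bnd_simp.
  have Nx : - N <= x by have := ler_norm (- x); rewrite normrN; lra.
  by rewrite /P (split_at x Nx) (split_at 0) ?oppr_le0//; ring.
exists (fun x => P (`|x| + 1) x) => x.
have PE : \forall y \near x, P (`|x| + 2) y = P (`|y| + 1) y.
  near=> y; apply/esym/PNM; first by rewrite lerDl.
  rewrite -lerBrDr -addrA (_ : 2 - 1 = 1); last by lra.
  rewrite -lerBlDl; apply: (le_trans (lerB_dist y x)); rewrite distrC.
  by near: y; apply: (@cvgr_dist_le _ _ _ _ _ (fun z => z) x); [exact: cvg_id|].
apply: (near_eq_is_derive PE).
have ux : x < x + 1 by rewrite ltrDl.
have xN : - (`|x| + 2) < x.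
  by have := ler_norm (- x); rewrite normrN; lra.
have [d1 d2] := continuous_FTC1_closed ux (fi (- (`|x| + 2)) (x + 1)) xN (cf x).
have dI : is_derive x 1
    (fun y => \int[lebesgue_measure]_(t in `[- (`|x| + 2), y]) f t) (f x).
  by have := derivableP d1; rewrite -derive1E d2.
by apply: (is_derive_eq (is_deriveB dI (is_derive_cst _ _ _))); rewrite subr0.
Unshelve. all: by end_near. Qed.

Lemma ge0_dense (R : realType) (f : R -> R) : continuous f ->
  (forall a b, a < b -> exists2 x, a < x < b & 0 <= f x) ->
  forall x, 0 <= f x.
Proof.
move=> cf df x; rewrite leNgt; apply/negP => fx0.
have : \forall y \near x, f y < 0.
  by have /cvgr_lt := cf x; apply.
move=> /nbhs_ballP[e /= e0]; rewrite ball_itv => xe.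
have [|y yxe] := df (x - e) (x + e); first by rewrite ltrBlDr -addrA ltrDl addr_gt0.
by rewrite leNgt xe//= in_itv.
Qed.

Lemma eq0_dense (R : realType) (f : R -> R) : continuous f ->
  (forall a b, a < b -> exists2 x, a < x < b & f x = 0) ->
  forall x, f x = 0.
Proof.
move=> cf df x; apply/eqP; rewrite eq_le -oppr_ge0; apply/andP; split.
  apply: (@ge0_dense _ (fun x => - f x)) => [y|a b ab].
    by apply: cvgN; exact: cf.
  by have [y yab fy] := df a b ab; exists y; rewrite ?fy ?oppr0.
apply: (@ge0_dense _ f) => // a b ab.
by have [y yab fy] := df a b ab; exists y; rewrite ?fy.
Qed.

Lemma is_derive_periodic (R : realType) (f g : R -> R) (w : R) :
  (forall x : R, is_derive x 1 f (g x)) -> periodic f w -> periodic g w.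
Proof.
move=> df pf x.
have dw : is_derive x 1 (fun x => x + w) 1.
  by apply: is_derive_eq; rewrite addr0.
have h : is_derive x 1 (f \o (fun x => x + w)) (g (x + w) * 1).
  exact: is_derive1_comp.
have fE : f \o (fun x => x + w) = f by apply/funext => y; exact: pf.
rewrite fE in h; rewrite -[LHS]mulr1.
by rewrite -(@derive_val _ _ _ _ _ _ _ h) (@derive_val _ _ _ _ _ _ _ (df x)).
Qed.

Lemma periodic_ndecr_derive0 (R : realType) (f g : R -> R) (w : R) : 0 < w ->
  (forall x : R, is_derive x 1 f (g x)) -> periodic f w ->
  (forall x, 0 <= g x) -> forall x, g x = 0.
Proof.
move=> w0 df pf g0.
have cf := is_derive_continuous df.
have ndf x y : x <= y -> f x <= f y.
  rewrite le_eqVlt => /predU1P[->//|xy].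
  have [c _ fc] := MVT xy (fun z _ => df z) (continuous_subspaceT cf).
  by rewrite -subr_ge0 fc mulr_ge0// subr_ge0 ltW.
have le_any x y : f x <= f y.
  have [n xy] : exists n : nat, x <= y + w *+ n.
    exists (Num.bound (`|x - y| / w)).
    rewrite -lerBlDl (le_trans (ler_norm _))// -[leRHS]mulr_natr.
    by rewrite -ler_pdivrMl// mulrC ltW// archi_boundP// divr_ge0// ltW.
  by rewrite -(periodicn pf n y); exact: ndf.
have fE : f = cst (f 0).
  by apply/funext => x; apply/eqP; rewrite eq_le !le_any.
move=> x; rewrite -(@derive_val _ _ _ _ _ _ _ (df x)) fE.
exact: derive_val.
Qed.

(** * Absence of vacuum *)

(** A nonnegative differentiable function vanishes to order more than one at
    its zeros, so that its inverse is not integrable there. *)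
Lemma loc_integrable_inv_gt0 (R : realType) (k : R) (rho rho' : R -> R) :
  0 < k -> (forall x : R, is_derive x 1 rho (rho' x)) ->
  (forall x, 0 <= rho x) ->
  loc_integrable (fun x => (k%:E * ((rho x)%:E)^-1)%E) ->
  forall x, 0 < rho x.
Proof.
move=> k0 drho rho0 ki x0; rewrite lt_neqAle rho0 andbT eq_sym.
apply/negP => /eqP r0.
pose F x := (k%:E * ((rho x)%:E)^-1)%E.
have F0 x : (0 <= F x)%E by rewrite mule_ge0 ?inve_ge0 ?lee_fin// ltW.
have /integrableP[mF iF] := ki _ (@segment_compact R x0 (x0 + 1)).
have {}iF : (\int[lebesgue_measure]_(x in `[x0, (x0 + 1)%R]) F x < +oo)%E.
  apply: le_lt_trans iF; apply: ge0_le_integral => //.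
    exact: measurableT_comp.
  by move=> x _; rewrite -/(F x) gee0_abs.
have dr : is_derive x0 1 rho 0.
  apply: (@derive1_at_min _ rho (x0 - 1) (x0 + 1)).
  - by lra.
  - by move=> t _; exact: ex_derive.
  - by rewrite in_itv/=; apply/andP; split; lra.
  - by move=> t _; rewrite r0.
pose I := fine (\int[lebesgue_measure]_(x in `[x0, (x0 + 1)%R]) F x)%E.
have I0 : 0 <= I by rewrite fine_ge0// integral_ge0.
(* [rho <= e * d] on an interval of length [d] makes the integral at least
   [k / e = I + 1] *)
pose e := k / (I + 1).
have e0 : 0 < e by rewrite divr_gt0// ltr_wpDl.
have [d [d0 d1 Hd]] : exists d : R, [/\ 0 < d, d <= 1 &
    forall x, x0 < x <= x0 + d -> rho x <= e * d].
  have [dd dv] := dr; move: (dd) => /cvg_ex[l hl].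
  have l0 : l = 0 by rewrite -dv; apply/esym/cvg_lim.
  rewrite l0 in hl; have /cvgr0Pnorm_le/(_ _ e0) := hl.
  move=> /nbhs_ballP[d /= d0 Hd].
  exists (Num.min 1 (d / 2)); split.
  - by rewrite lt_min ltr01 divr_gt0.
  - by rewrite ge_min lexx.
  - move=> x /andP[x0x xd].
    have hx : 0 < x - x0 by rewrite subr_gt0.
    have hxd : x - x0 <= Num.min 1 (d / 2) by rewrite lerBlDl.
    have := Hd (x - x0); rewrite /= r0 subr0 scaler1 subrK.
    rewrite -ball_normE/= sub0r normrN gtr0_norm// => H.
    have {}H : `|(x - x0)^-1 *: rho x| <= e.
      apply: H; last by rewrite gt_eqF.
      rewrite (le_lt_trans hxd)// gt_min.
      by rewrite ltr_pdivrMr// ltr_pMr// ltr1n orbT.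
    rewrite normrZ (ger0_norm (rho0 _)) gtr0_norm ?invr_gt0// in H.
    rewrite ler_pdivrMl// mulrC in H.
    by rewrite (le_trans H)// ler_wpM2l// ltW.
have : ((I + 1)%:E <= I%:E)%E.
  rewrite fineK ?ge0_fin_numE ?integral_ge0//.
  have sub : `]x0, (x0 + d)%R]%classic `<=` `[x0, (x0 + 1)%R]%classic.
    move=> x; rewrite /= !in_itv/= => /andP[x0x xd].
    by rewrite ltW//= (le_trans xd)// lerD2l.
  apply: (@le_trans _ _ (\int[lebesgue_measure]_(x in `]x0, (x0 + d)%R]) F x)%E);
    last exact: ge0_subset_integral.
  apply: (@le_trans _ _
    (\int[lebesgue_measure]_(x in `]x0, (x0 + d)%R]) (cst ((I + 1) / d)%:E x))%E).
    rewrite integral_cst//= lebesgue_measure_itv/= lte_fin ltrDl d0.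
    by rewrite -EFinB addrAC subrr add0r -EFinM divfK// gt_eqF.
  apply: ge0_le_integral => //.
  - by move=> x _; rewrite lee_fin divr_ge0// ?addr_ge0// ltW.
  - exact: measurable_funS mF.
  - move=> x; rewrite /= in_itv/= => /Hd rx.
    rewrite /F inver; case: ifPn => [_|rx0]; first by rewrite gt0_muley ?leey.
    have {}rx0 : 0 < rho x by rewrite lt_neqAle eq_sym rx0 rho0.
    rewrite lee_fin ler_pdivlMr// mulrAC ler_pdivrMr//.
    by rewrite -ler_pdivlMl ?ltr_wpDl// mulrA (mulrC _ k).
by rewrite lee_fin gerDl ler10.
Qed.

(** * The energy argument *)

(** Here [c] is the constant of integration of the momentum balance, [mub] is
    the viscosity along the solution and [u1] is the derivative of the velocity
    [m0 / rho].  The integrated balance is only assumed at the points of a dense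
    set, as [mub] need not be continuous. *)
Lemma energy_argument (R : realType) (m0 c w : R) (p mub K G : R -> R)
    (rho rho1 : R -> R) :
  m0 != 0 -> 0 < w ->
  (forall r, 0 < r -> {for r, continuous p}) ->
  (forall x, 0 < rho x) -> (forall x, 0 < mub x) ->
  (forall x : R, is_derive x 1 rho (rho1 x)) -> continuous rho1 ->
  continuous K -> (forall x : R, is_derive x 1 G (K x * rho1 x)) ->
  periodic rho w -> periodic K w ->
  let u1 x := - (m0 * rho1 x / rho x ^+ 2) in
  (forall a b, a < b -> exists2 x, a < x < b &
     m0 ^+ 2 / rho x + p (rho x) - mub x * u1 x - (K x * rho x - G x) = c) ->
  forall x, rho1 x = 0.
Proof.
move=> m00 w0 cp rho0 mub0 drho crho1 cK dG prho pK u1 dense.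
have rn0 x : rho x != 0 by rewrite gt_eqF.
have crho := is_derive_continuous drho.
have prho1 := is_derive_periodic drho prho.
have cG := is_derive_continuous dG.
pose u x := m0 / rho x.
have du (x : R) : is_derive x 1 u (u1 x).
  have dV := @is_deriveV _ rho x _ _ (rn0 x) (drho x).
  apply: (is_derive_eq (is_deriveM (is_derive_cst m0 x 1) dV)).
  by rewrite /u1 /GRing.scale/=; field.
have pu : periodic u w by move=> x; rewrite /u prho.
have pu1 : periodic u1 w by move=> x; rewrite /u1 prho prho1.
have u1_rho1 x : u1 x = 0 -> rho1 x = 0.
  move/eqP; rewrite oppr_eq0 !mulf_eq0 invr_eq0 expf_eq0/= (negPf m00).
  by rewrite (negPf (rn0 x)) orbF => /eqP.
have crhoV : continuous (fun x => (rho x)^-1).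
  by move=> x; apply: cvgV => //; exact: crho.
have cu1 : continuous u1.
  move=> x; apply: cvgN; apply: cvgM.
    by apply: cvgM; [exact: cvg_cst|exact: crho1].
  apply: cvgV; first by rewrite expf_neq0.
  by apply: cvgM; exact: crho.
pose H x := m0 ^+ 2 / rho x + p (rho x) - K x * rho x + G x - c.
have cH : continuous H.
  move=> x; apply: cvgB; last exact: cvg_cst.
  apply: cvgD; last exact: cG.
  apply: cvgB; last by apply: cvgM; [exact: cK|exact: crho].
  apply: cvgD; first by apply: cvgM; [exact: cvg_cst|exact: crhoV].
  by apply: continuous_comp; [exact: crho|exact: cp].
have denseH a b : a < b -> exists2 x, a < x < b & H x = mub x * u1 x.
  by move=> ab; have [x xab xc] := dense a b ab; exists x => //; rewrite /H -xc; ring.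
have Hu1_ge0 : forall x, 0 <= H x * u1 x.
  apply: ge0_dense => [x|a b ab]; first by apply: cvgM; [exact: cH|exact: cu1].
  have [x xab Hx] := denseH a b ab; exists x => //.
  by rewrite Hx -mulrA -expr2 mulr_ge0 ?sqr_ge0// ltW.
pose d := G w - G 0.
have Gd x : G (x + w) = G x + d.
  have h : forall y : R, is_derive y 1 (fun y => G (y + w) - G y) 0.
    move=> y.
    have dw : is_derive y 1 (fun y => y + w) 1.
      by apply: is_derive_eq; rewrite addr0.
    have dGw := @is_derive1_comp _ G (fun y => y + w) y _ _ (dG _) dw.
    apply: (is_derive_eq (is_deriveB dGw (dG y))).
    by rewrite pK prho1 mulr1 subrr.
  have := @is_derive_0_is_cst _ _ x 0 h; rewrite /= add0r -/d => <-.
  by ring.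
have Hn n x : H (x + w *+ n) = H x + d *+ n.
  elim: n => [|n IH]; first by rewrite !mulr0n !addr0.
  rewrite !mulrSr addrA /H prho pK Gd.
  by move: IH; rewrite /H; lra.
(* otherwise [(H x + n * d) * u1 x] would be negative for large [n] *)
have du1_ge0 x : 0 <= d * u1 x.
  rewrite leNgt; apply/negP => du0.
  have [n Hdn] : exists n : nat, H x * u1 x < - (d * u1 x) * n%:R.
    exists (Num.bound (H x * u1 x / - (d * u1 x))).
    rewrite -ltr_pdivrMl ?oppr_gt0// mulrC archi_boundP//.
    by rewrite divr_ge0// oppr_ge0 ltW.
  have := Hu1_ge0 (x + w *+ n); rewrite Hn (periodicn pu1) -mulr_natr.
  by rewrite leNgt => /negP; apply; rewrite mulrDl; lra.
have du1_0 : forall x, d * u1 x = 0.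
  have ddu (x : R) : is_derive x 1 (fun x => d * u x) (d * u1 x).
    apply: (is_derive_eq (is_deriveM (is_derive_cst d x 1) (du x))).
    by rewrite /GRing.scale/= mulr0 addr0.
  apply: (periodic_ndecr_derive0 w0 ddu) => // x.
  by rewrite pu.
have [d0|d0] := eqVneq d 0; last first.
  move=> x; apply: u1_rho1; apply/eqP.
  by have /eqP := du1_0 x; rewrite mulf_eq0 (negPf d0).
(* The logarithmic variable makes the integrand of [Q] continuous on the whole
   line, whereas [p] is controlled on positive densities only. *)
pose q t := - (m0 * p (expR t) * expR (- t)).
have cq : continuous q.
  move=> t; apply: cvgN; apply: cvgM.
    apply: cvgM; first exact: cvg_cst.
    apply: (@continuous_comp _ _ _ expR p); first exact: continuous_expR.
    by apply: cp; exact: expR_gt0.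
  apply: (@continuous_comp _ _ _ -%R expR); last exact: continuous_expR.
  exact: opp_continuous.
have [Q dQ] := continuous_primitive cq.
pose W x := m0 / 2 * (u x * u x) + Q (ln (rho x)) + u x * (G x - c).
have dW (x : R) : is_derive x 1 W (H x * u1 x).
  have dln := @is_derive1_comp _ (@ln R) rho x _ _ (is_derive1_ln (rho0 x)) (drho x).
  have dQl := @is_derive1_comp _ Q (@ln R \o rho) x _ _ (dQ _) dln.
  have du2 := is_deriveM (du x) (du x).
  have dt1 := is_deriveM (is_derive_cst (m0 / 2) x 1) du2.
  have dGc := is_deriveB (dG x) (is_derive_cst c x 1).
  have dt2 := is_deriveM (du x) dGc.
  apply: (is_derive_eq (is_deriveD (is_deriveD dt1 dQl) dt2)).
  rewrite /GRing.scale/= /q lnK ?posrE// expRN lnK ?posrE//.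
  by rewrite /H /u1 /u !fctE; field.
have HU0 : forall x, H x * u1 x = 0.
  apply: (periodic_ndecr_derive0 w0 dW) => // x.
  by rewrite /W pu prho Gd d0 addr0.
move=> x; apply: u1_rho1; move: x; apply: eq0_dense => // a b ab.
have [x xab Hx] := denseH a b ab; exists x => //; apply/eqP.
have /eqP := HU0 x; rewrite Hx !mulf_eq0 (gt_eqF (mub0 x))/=.
by rewrite orbb.
Qed.

(** * From the weak formulation to a pointwise identity *)

Lemma derive1_out (R : realType) (phi : R -> R) (M : R) :
  (forall x, M < `|x| -> phi x = 0) -> forall x, M < `|x| -> derive1 phi x = 0.
Proof.
move=> phi0 x Mx; rewrite derive1E.
have h : \near x, cst 0 x = phi x.
  near=> y; rewrite phi0//; near: y.
  have cn : (fun y : R => `|y|) @ x --> `|x| by exact: norm_continuous.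
  by have /cvgr_gt := cn; apply.
by rewrite -(near_eq_derive _ h); exact: derive_val.
Unshelve. all: by end_near. Qed.

Lemma locally_lipschitz_continuous (R : realType) (A : set R) (f : R -> R) :
  locally_lipschitz A f -> forall x, A x -> {for x, continuous f}.
Proof.
move=> fl x Ax; have [U Ux lipU] := fl x Ax.
have [k k0 Hk] : exists2 k : R, 0 < k & forall y z, U y -> U z ->
    `|f y - f z| <= k * `|y - z|.
  have /pinfty_ex_gt0[k k0 Hk] := lipU.
  by exists k => // y z Uy Uz; have := Hk (y, z); apply.
apply/cvgrPdist_le => e e0.
near=> y.
have Uy : U y by near: y.
apply: le_trans (Hk _ _ (nbhs_singleton Ux) Uy) _.
rewrite -ler_pdivlMl//; near: y.
have /cvgrPdist_le := @cvg_id _ (nbhs x); apply.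
by rewrite mulr_gt0// invr_gt0.
Unshelve. all: by end_near. Qed.

(** If [G] is a primitive of [K rho'], the Korteweg force [rho d(K)] is the
    distributional derivative of [K rho - G]. *)
Lemma distr_mul_deriv (R : realType) (K G rho rho1 phi : R -> R) :
  continuous K -> (forall x : R, is_derive x 1 rho (rho1 x)) ->
  continuous rho1 -> (forall x : R, is_derive x 1 G (K x * rho1 x)) ->
  test_function phi ->
  distr_mul rho (distr_deriv K) phi =
  distr_deriv (fun x => K x * rho x - G x) phi.
Proof.
move=> cK drho crho1 dG [phiC [M phi0]]; rewrite /distr_mul /distr_deriv.
apply/eqP; rewrite eqr_opp; apply/eqP.
have dphi (x : R) : is_derive x 1 phi (derive1 phi x).
  by rewrite derive1E; apply: derivableP; have [/(_ 0%N isT)] := phiC 1.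
have cdphi : continuous (derive1 phi) by have [] := phiC 1.
have cphi := is_derive_continuous dphi.
have crho := is_derive_continuous drho.
have cG := is_derive_continuous dG.
have out x : x \notin `[- (`|M| + 1), `|M| + 1] -> M < `|x|.
  rewrite in_itv/= -ler_norml -ltNge; apply: le_lt_trans.
  by rewrite (le_trans (ler_norm _))// lerDl.
have drp (x : R) : derive1 (rho \* phi) x = rho x * derive1 phi x + phi x * rho1 x.
  by rewrite derive1E; apply: derive_val; exact: is_deriveM.
have dGp (x : R) : is_derive x 1 (fun x => G x * phi x)
    (G x * derive1 phi x + phi x * (K x * rho1 x)).
  exact: is_deriveM.
have cGp : continuous (fun x => G x * derive1 phi x + phi x * (K x * rho1 x)).
  move=> x; apply: cvgD; first by apply: cvgM; [exact: cG|exact: cdphi].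
  apply: cvgM; first exact: cphi.
  by apply: cvgM; [exact: cK|exact: crho1].
have Gp0 x : x \notin `[- (`|M| + 1), `|M| + 1] ->
    G x * derive1 phi x + phi x * (K x * rho1 x) = 0.
  by move=> /out Mx; rewrite (derive1_out phi0)// phi0// mulr0 mul0r addr0.
have ltM : - (`|M| + 1) < `|M| + 1 by have := normr_ge0 M; lra.
have intGp : \int[lebesgue_measure]_(x in setT)
    (G x * derive1 phi x + phi x * (K x * rho1 x)) = 0.
  rewrite (Rintegral_derive_support ltM dGp cGp Gp0).
  rewrite !phi0 ?mulr0 ?subrr// ?normrN ger0_norm ?addr_ge0//;
    by rewrite (le_lt_trans (ler_norm _))// ltrDl.
have -> : \int[lebesgue_measure]_(x in setT) (K x * derive1 (rho \* phi) x) =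
  \int[lebesgue_measure]_(x in setT) ((K x * rho x - G x) * derive1 phi x +
    (G x * derive1 phi x + phi x * (K x * rho1 x))).
  by apply: eq_Rintegral => x _; rewrite drp; ring.
rewrite RintegralD ?intGp ?addr0//.
- apply: (integrable_mul_support _ cdphi) => [|x /out]; last exact: derive1_out.
  apply: continuous_loc_integrable => x; apply: cvgB; last exact: cG.
  by apply: cvgM; [exact: cK|exact: crho].
- rewrite (_ : EFin \o _ = EFin \o ((fun=> 1) \*
    (fun x => G x * derive1 phi x + phi x * (K x * rho1 x)))); last first.
    by apply/funext => x /=; rewrite mul1r.
  apply: (integrable_mul_support _ cGp Gp0).
  by apply: continuous_loc_integrable => x; exact: cvg_cst.
Qed.

Unset Implicit Arguments.
Set Strict Implicit.

Theorem theorem2p1 (R : realType) (p eps lam mu rho m : R -> R) (omega : R)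
  (hp : locally_lipschitz `]0, +oo[ p)
  (heps : {within `[0, +oo[, continuous eps})
  (hmubar_gt0 : forall r, 0 < r -> 0 < total_viscosity lam mu r)
  (heps_gt0 : forall r, 0 < r -> 0 < eps r)
  (homega : 0 < omega)
  (hrho_per : periodic rho omega)
  (hm_per : periodic m omega)
  (hrho_ge0 : forall x, 0 <= rho x)
  (hsol : C2_solution p eps lam mu rho m)
  (hm_neq0 : exists x, m x != 0) :
  exists c : R, forall x, rho x = c.
Proof.
have [Crho Cm [fluxi presi stressi kori] mass momentum] := hsol.
have [drho0 crho2] := Crho.
have [dm0 _] := Cm.
pose rho1 := derive1 rho; pose rho2 := derive1 rho1.
have drho (x : R) : is_derive x 1 rho (rho1 x).
  by rewrite /rho1 derive1E; apply: derivableP; exact: (drho0 0%N).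
have drho1 (x : R) : is_derive x 1 rho1 (rho2 x).
  by rewrite /rho2 derive1E; apply: derivableP; exact: (drho0 1%N).
have dm (x : R) : is_derive x 1 m 0.
  rewrite -(mass x) derive1E; apply: derivableP; exact: (dm0 0%N).
have crho := is_derive_continuous drho.
have crho1 := is_derive_continuous drho1.
have [m0 [m00 mE]] : exists m0, m0 != 0 /\ m = cst m0.
  have [x0 mx0] := hm_neq0; exists (m x0); split => //.
  by apply/funext => x; exact: is_derive_0_is_cst.
subst m.
have m02 : 0 < m0 ^+ 2 by rewrite exprn_even_gt0.
have rho0 : forall x, 0 < rho x := loc_integrable_inv_gt0 m02 drho hrho_ge0 fluxi.
have rn0 x : rho x != 0 by rewrite gt_eqF.
have cp r : 0 < r -> {for r, continuous p}.
  by move=> r0; apply: (locally_lipschitz_continuous hp); rewrite /= in_itv/= r0.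
have ceps r : 0 < r -> {for r, continuous eps}.
  move=> r0; have : {within `]0, +oo[, continuous eps}.
    apply: continuous_subspaceW heps => z.
    by rewrite /= !in_itv/= !andbT; exact: ltW.
  rewrite continuous_open_subspace//; apply.
  by rewrite inE/= in_itv/= r0.
pose K x := eps (rho x) * rho2 x.
have KE : korteweg eps rho = K by [].
have cK : continuous K.
  move=> x; apply: cvgM; last exact: crho2.
  by apply: continuous_comp; [exact: crho|exact: ceps].
have prho1 : periodic rho1 omega := is_derive_periodic drho hrho_per.
have pK : periodic K omega.
  by move=> x; rewrite /K hrho_per (is_derive_periodic drho1 prho1).
have [G dG] : exists G : R -> R, forall x : R, is_derive x 1 G (K x * rho1 x).
  apply: continuous_primitive => x.
  by apply: cvgM; [exact: cK|exact: crho1].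
have cG := is_derive_continuous dG.
pose Fl := momentum_flux rho (cst m0); pose P := pressure p rho.
pose S := viscous_stress lam mu rho (cst m0).
pose J x := K x * rho x - G x.
have cFl : continuous Fl.
  change (continuous (fun x => m0 ^+ 2 * (rho x)^-1)).
  move=> x; apply: cvgM; first exact: cvg_cst.
  by apply: cvgV => //; exact: crho.
have Fli := continuous_loc_integrable cFl.
have Ji : loc_integrable (EFin \o J).
  apply: continuous_loc_integrable => x; apply: cvgB; last exact: cG.
  by apply: cvgM; [exact: cK|exact: crho].
pose f x := Fl x + P x - S x - J x.
have fi : loc_integrable (EFin \o f).
  move=> A cA; have mA := compact_measurable cA.
  have -> : EFin \o f = ((EFin \o Fl) \+ (EFin \o P) \- (EFin \o S)
      \- (EFin \o J))%E.
    by apply/funext => x; rewrite /f /= !EFinB EFinD.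
  apply: integrableB => //; last exact: Ji.
  apply: integrableB => //; last exact: stressi.
  by apply: integrableD => //; [exact: Fli|exact: presi].
have f_phi phi : test_function phi ->
    \int[lebesgue_measure]_(x in setT) (f x * derive1 phi x) = 0.
  move=> tphi; have := momentum phi tphi.
  rewrite KE (@distr_mul_deriv _ _ G _ rho1)// /distr_deriv -/Fl -/P -/S.
  have [phiC [M phi0]] := tphi.
  have cdphi : continuous (derive1 phi) by have [] := phiC 1%N.
  have out x : x \notin `[- `|M|, `|M|] -> derive1 phi x = 0.
    rewrite in_itv/= -ler_norml -ltNge => Mx; apply: (derive1_out phi0).
    by rewrite (le_lt_trans (ler_norm _)).
  have i1 := integrable_mul_support Fli cdphi out.
  have i2 := integrable_mul_support presi cdphi out.
  have i3 := integrable_mul_support stressi cdphi out.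
  have i4 := integrable_mul_support Ji cdphi out.
  have i12 := integrableD measurableT i1 i2.
  have i123 := integrableB measurableT i12 i3.
  have -> : \int[lebesgue_measure]_(x in setT) (f x * derive1 phi x) =
     \int[lebesgue_measure]_(x in setT) (Fl x * derive1 phi x +
       P x * derive1 phi x - S x * derive1 phi x - J x * derive1 phi x).
    by apply: eq_Rintegral => x _; rewrite /f; ring.
  rewrite RintegralB// RintegralB// RintegralD// => momphi.
  by rewrite -/J in momphi; lra.
have [c dense] := du_bois_reymond_dense fi f_phi.
exists (rho 0) => x; apply: is_derive_0_is_cst => y.
have rho1_0 : forall x, rho1 x = 0.
  apply: (@energy_argument R m0 c omega p (total_viscosity lam mu \o rho)
    K G rho rho1) => //=.
    by move=> z; exact: hmubar_gt0.
  move=> a b ab; have [z zab fz] := dense a b ab; exists z => //.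
  rewrite -fz /f /J /Fl /P /S /momentum_flux /pressure /viscous_stress /=.
  suff -> : derive1 (velocity rho (cst m0)) z = - (m0 * rho1 z / rho z ^+ 2).
    by [].
  rewrite derive1E; apply: derive_val.
  have dV := @is_deriveV _ rho z _ _ (rn0 z) (drho z).
  apply: (is_derive_eq (is_deriveM (is_derive_cst m0 z 1) dV)).
  by rewrite /GRing.scale/=; field.
by rewrite -(rho1_0 y).
Qed.
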